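(* There exists a Jordan-measurable coloring of the plane $\mathbb{R}^2$ in $25$ colors such that no color-class contains the (four) vertices of a rectangle of area $1$.
   Context: A coloring of $\mathbb{R}^2$ in $r$ colors is a partition of $\mathbb{R}^2$ into $r$ sets, called color-classes. It is Jordan-measurable if the boundary of every color-class has Lebesgue measure $0$. Rectangles may be arbitrarily rotated (they need not be axes-aligned). *)

(* Defs.v *)
From HB Require Import structures.
From mathcomp Require Import all_boot all_order all_algebra.
From mathcomp Require Import all_classical all_reals all_analysis.
Import Order.TTheory GRing.Theory Num.Theory.
Import numFieldNormedType.Exports.

Set Implicit Arguments.
Unset Strict Implicit.
Unset Printing Implicit Defensive.

Local Open Scope classical_set_scope.
Local Open Scope ring_scope.

Definition coloring (T : Type) (r : nat) (C : 'I_r -> set T) : Prop :=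
  partition [set: 'I_r] C [set: T].

Definition boundary (T : topologicalType) (A : set T) : set T :=
  closure A `\` interior A.

Definition lebesgue_measure2 (R : realType) : set (R * R) -> \bar R :=
  (@lebesgue_measure R \x @lebesgue_measure R)%E.

Definition jordan_measurable_coloring (R : realType) (r : nat)
    (C : 'I_r -> set (R * R)) : Prop :=
  coloring C /\ forall i, lebesgue_measure2 (boundary (C i)) = 0%E.

Definition dotp (R : realType) (u v : R * R) : R := u.1 * v.1 + u.2 * v.2.

(* The library norm on R * R is the sup norm, hence this Euclidean one. *)
Definition eucl_norm (R : realType) (u : R * R) : R := Num.sqrt (dotp u u).

(* Vertices are listed in cyclic order: a nondegenerate parallelogram abcd with
   a right angle at a. *)
Definition is_rectangle (R : realType) (a b c d : R * R) : Prop :=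
  [/\ a != b, a != d, b - a = c - d & dotp (b - a) (d - a) = 0].

Definition rectangle_area (R : realType) (a b c d : R * R) : R :=
  eucl_norm (b - a) * eucl_norm (d - a).

Definition contains_rectangle_vertices (R : realType) (A : set (R * R))
    (s : R) : Prop :=
  exists a b c d : R * R,
    [/\ is_rectangle a b c d, rectangle_area a b c d = s &
        [/\ A a, A b, A c & A d]].

(* Main.v *)
Require Import Defs.
From HB Require Import structures.
From mathcomp Require Import all_boot all_order all_algebra.
From mathcomp Require Import all_classical all_reals all_analysis.
From mathcomp Require Import ring lra zify.
Import Order.TTheory GRing.Theory Num.Theory.
Import numFieldNormedType.Exports.

Set Implicit Arguments.
Unset Strict Implicit.
Unset Printing Implicit Defensive.

(* Identify the plane with the complex numbers.  For a rectangle abcd with sides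
   u, v one has a^2 - b^2 + c^2 - d^2 = 2uv, so the alternating sum of
   f(z) = (1 + i) z^2 over the vertices of a rectangle of area 1 lies on the
   circle of radius 2 sqrt 2.  Colour z by the integer parts mod 5 of the two
   coordinates of f(z).  On a monochromatic rectangle each coordinate of the
   alternating sum lies in 5Z + (-2, 2), hence in (-2, 2) because 2 sqrt 2 < 3,
   so its squared length is less than 8.  Boundaries of the colour classes are
   covered by the curves where a coordinate of f is an integer; the factor 1 + i
   makes both coordinates nondegenerate quadratics in y for every x, so these
   curves have countable vertical sections. *)

Local Open Scope classical_set_scope.
Local Open Scope ring_scope.

Definition residue5 (R : realType) (t : R) : nat := `|(Num.floor t %% 5)%Z|%N.

Lemma residue5_lt (R : realType) (t : R) : (residue5 t < 5)%N.
Proof. by rewrite /residue5; lia. Qed.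

Lemma residue5P (R : realType) (t : R) : exists m : int,
  5 * m%:~R + (residue5 t)%:R <= t < 5 * m%:~R + (residue5 t)%:R + 1.
Proof.
exists (Num.floor t %/ 5)%Z.
have := floor_itv t.
have {1 2}-> : Num.floor t = 5 * (Num.floor t %/ 5)%Z + (residue5 t)%:Z.
  by rewrite /residue5; lia.
by rewrite !intrD !intrM -!pmulrn.
Qed.

Lemma residue5_natDM (R : realType) (n m : nat) :
  (n < 5)%N -> residue5 ((n + 5 * m)%:R : R) = n.
Proof.
move=> n5; rewrite /residue5 pmulrn intrKfloor; lia.
Qed.

(** Off the integers, [t] lies strictly inside its unit interval, so the floor is locally constant
    there. *)
Lemma near_residue5 (R : realType) (t : R) : t \isn't a Num.int ->
  \forall s \near t, residue5 s = residue5 t.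
Proof.
rewrite intrEfloor => tNint.
have /andP[lt_ft tlt] := floor_itv t.
have {tNint}lt_ft : (Num.floor t)%:~R < t by rewrite lt_neqAle tNint.
near=> s; rewrite /residue5; congr (`|(_ %% 5)%Z|%N); apply: floor_def.
apply/andP; split; first apply: ltW; near: s.
- exact: lt_nbhsr.
- exact: lt_nbhsl.
Unshelve. all: by end_near. Qed.

Lemma residue5_alternating (R : realType) (a b c d : R) :
  residue5 a = residue5 b -> residue5 a = residue5 c ->
  residue5 a = residue5 d -> `|a - b + c - d| < 3 -> `|a - b + c - d| < 2.
Proof.
move=> eab eac ead.
have [ma] := residue5P a; have [mb] := residue5P b.
have [mc] := residue5P c; have [md] := residue5P d.
rewrite -eab -eac -ead; set r := _%:R => Hd Hc Hb Ha.
rewrite !ltr_norml => /andP[lo hi].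
(* The common residue cancels, so the alternating sum differs from 5m by a signed sum of four
   fractional parts, which lies in (-2, 2). The bound 3 then leaves only m = 0. *)
set m := ma - mb + mc - md.
have mE : m%:~R = ma%:~R - mb%:~R + mc%:~R - md%:~R :> R.
  by rewrite /m !(intrD, rmorphN).
have m0 : m = 0.
  have m1 : (m < 1)%R by rewrite -(ltr_int R) mE; lra.
  have m2 : (-1 < m)%R by rewrite -(ltr_int R) mE; lra.
  lia.
move: mE; rewrite m0 => mE.
apply/andP; split; lra.
Qed.

(* [(1 + i) * z ^ 2 = qform (-1) z + i * qform 1 z]. *)
Definition qform (R : realType) (s : R) (z : R * R) : R :=
  z.1 ^+ 2 - z.2 ^+ 2 + 2 * s * (z.1 * z.2).

Lemma continuous_qform (R : realType) (s : R) : continuous (qform s).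
Proof.
move=> z; have c1 : fst @ z --> z.1 by exact: cvg_fst.
have c2 : snd @ z --> z.2 by exact: cvg_snd.
apply: cvgD; first by apply: cvgB; rewrite expr2; apply: cvgM.
by apply: cvgM; [exact: cvg_cst | exact: cvgM].
Qed.

(** Completing the square turns [qform s (x, y) = n] into (y - sx)^2 = (s^2 + 1)x^2 - n, which has
    at most two solutions y for each integer n. *)
Lemma countable_qform_section (R : realType) (s x : R) :
  countable [set y | qform s (x, y) \is a Num.int].
Proof.
pose w (n : int) := Num.sqrt ((s ^+ 2 + 1) * x ^+ 2 - n%:~R).
apply: (sub_countable (B := \bigcup_n [set s * x + w n; s * x - w n])).
  apply: subset_card_le => y /= /intrP[n yn]; exists n => //=.
  have : `|y - s * x| = w n.
    by rewrite -sqrtr_sqr /w -yn /qform /=; congr Num.sqrt; ring.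
  by case: ger0P => _ <-; [left | right]; ring.
by apply: bigcup_countable => // n _; apply: finite_set_countable.
Qed.

(** Used to show that every colour occurs. The witness is the principal square root of u + iv = (p +
    iq) / (1 + i), and r is the modulus of u + iv. Since u > 0, the real part x is nonzero and y = v
    / (2x) makes sense. *)
Lemma qform_surj (R : realType) (p q : R) : 0 < p + q ->
  exists z, qform (-1) z = p /\ qform 1 z = q.
Proof.
move=> pq; pose u := (p + q) / 2; pose v := (q - p) / 2.
have u0 : 0 < u by rewrite /u; lra.
pose r := Num.sqrt (u ^+ 2 + v ^+ 2).
have r2 : r ^+ 2 = u ^+ 2 + v ^+ 2 by rewrite sqr_sqrtr// addr_ge0 ?sqr_ge0.
have ru : 0 < (r + u) / 2.
  by rewrite divr_gt0// ltr_wpDl// sqrtr_ge0.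
pose x := Num.sqrt ((r + u) / 2).
have x0 : 0 < x by rewrite sqrtr_gt0.
have x2 : x ^+ 2 = (r + u) / 2 by rewrite sqr_sqrtr// ltW.
pose y := v / (2 * x).
have xy : 2 * (x * y) = v by rewrite /y; field; rewrite gt_eqF.
have y2 : y ^+ 2 = (r - u) / 2.
  have ru0 : (r + u) / 2 != 0 by rewrite gt_eqF.
  apply: (mulfI ru0); rewrite -{1}x2 -exprMn.
  have -> : x * y = v / 2 by rewrite -xy; field.
  rewrite -[RHS]/((r + u) / 2 * ((r - u) / 2)).
  have -> : (v / 2) ^+ 2 = v ^+ 2 / 4 by field.
  have -> : v ^+ 2 = r ^+ 2 - u ^+ 2 by rewrite r2; ring.
  by field.
exists (x, y); rewrite /qform /= x2 y2.
by rewrite mulrN1 mulNr mulr1 xy /v /u; split; field.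
Qed.

(** With u = b - a and v = d - a, the left side is |2(1 + i)uv|^2, and the complex modulus is
    multiplicative. *)
Lemma qform_rectangle (R : realType) (a b c d : R * R) :
  let Q s := qform s a - qform s b + qform s c - qform s d in
  is_rectangle a b c d ->
  Q (-1) ^+ 2 + Q 1 ^+ 2 = 8 * rectangle_area a b c d ^+ 2.
Proof.
case: a b c d => [a1 a2] [b1 b2] [c1 c2] [d1 d2] Q [_ _ par _].
have dot0 (u : R * R) : 0 <= dotp u u by rewrite addr_ge0// -expr2 sqr_ge0.
rewrite /rectangle_area exprMn !sqr_sqrtr// /dotp /Q /qform /=.
case: par => /(canRL (subrK _)) e1 /(canRL (subrK _)) e2.
have -> : c1 = b1 - a1 + d1 by rewrite e1; ring.
have -> : c2 = b2 - a2 + d2 by rewrite e2; ring.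
ring.
Qed.

Definition colour_class (R : realType) (k : 'I_25) : set (R * R) :=
  [set z | (residue5 (qform (-1) z) * 5 + residue5 (qform 1 z))%N = k].

(** The two residues are the base-5 digits of [k], hence determined by it. *)
Lemma colour_class_residue5 (R : realType) (k : 'I_25) (s : R) z w :
  s = -1 \/ s = 1 -> colour_class k z -> colour_class k w ->
  residue5 (qform s z) = residue5 (qform s w).
Proof.
rewrite /colour_class /= => hs <-.
have := residue5_lt (qform (-1) z); have := residue5_lt (qform (-1) w).
have := residue5_lt (qform 1 z); have := residue5_lt (qform 1 w).
case: hs => ->; lia.
Qed.

Lemma colour_class_no_unit_rectangle (R : realType) (k : 'I_25) :
  ~ contains_rectangle_vertices (@colour_class R k) 1.
Proof.
move=> [a [b [c [d [rect area [Ca Cb Cc Cd]]]]]].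
have := qform_rectangle rect; rewrite area.
set X := qform (-1) a - _ + _ - _; set Y := qform 1 a - _ + _ - _.
rewrite expr1n mulr1 => XY.
have lt3 (x y : R) : x ^+ 2 + y ^+ 2 = 8 -> `|x| < 3.
  move=> xy; rewrite -(@ltr_pXn2r _ 2)// ?nnegrE// real_normK ?num_real//.
  by have := sqr_ge0 y; lra.
have lt2 (s : R) : s = -1 \/ s = 1 ->
    `|qform s a - qform s b + qform s c - qform s d| < 3 ->
    `|qform s a - qform s b + qform s c - qform s d| < 2.
  by move=> hs; apply: residue5_alternating; apply: (@colour_class_residue5 _ k).
have /(lt2 _ (or_introl erefl)) X2 := lt3 _ _ XY.
have YX : Y ^+ 2 + X ^+ 2 = 8 by rewrite addrC.
have /(lt2 _ (or_intror erefl)) Y2 := lt3 _ _ YX.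
have lt4 (x : R) : `|x| < 2 -> x ^+ 2 < 4.
  move=> x2; rewrite -(real_normK (num_real x)).
  by have := normr_ge0 x; nra.
by have := lt4 _ X2; have := lt4 _ Y2; rewrite -/X -/Y; lra.
Qed.

Lemma colour_class_coloring (R : realType) : coloring (@colour_class R).
Proof.
split.
- rewrite -subTset => z _.
  have lt25 : (residue5 (qform (-1) z) * 5 + residue5 (qform 1%R z) < 25)%N.
    have := residue5_lt (qform (-1) z); have := residue5_lt (qform 1 z); lia.
  by exists (Ordinal lt25).
- by move=> i j _ _ [z [/= zi zj]]; apply: val_inj; rewrite /= -zi -zj.
- move=> k _; pose i := (k %/ 5)%N; pose j := (k %% 5)%N.
  (* Adding 5 keeps the residues and makes the sum positive even when both digits are 0. *)
  have [|z [z1 z2]] := @qform_surj R (i + 5 * 1)%:R (j + 5 * 1)%:R.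
    by rewrite -natrD ltr0n; lia.
  exists z; rewrite /colour_class /= z1 z2 !residue5_natDM; last 2 first.
  - by rewrite /j; lia.
  - by have := ltn_ord k; rewrite /i; lia.
  by rewrite -divn_eq.
Qed.

(** Off these curves both residues are locally constant, so a point in the closure of a class is
    already interior to it. *)
Lemma boundary_colour_class (R : realType) (k : 'I_25) :
  boundary (@colour_class R k) `<=`
  [set z | qform (-1) z \is a Num.int] `|` [set z | qform 1 z \is a Num.int].
Proof.
move=> z [clz nintz]; apply: contrapT => /= /not_orP[/negP z1 /negP z2].
have near1 (s : R) : qform s z \isn't a Num.int ->
    \forall w \near z, residue5 (qform s w) = residue5 (qform s z).
  by move=> zs; exact: (@continuous_qform R s z _ (near_residue5 zs)).
have near_class : \forall w \near z,
    residue5 (qform (-1) w) = residue5 (qform (-1) z) /\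
    residue5 (qform 1 w) = residue5 (qform 1 z).
  by apply: filterI; exact: near1.
have [w [Cw [w1 w2]]] := clz _ near_class.
apply: nintz; apply: filterS near_class => v [v1 v2].
by rewrite /colour_class /= v1 v2 -w1 -w2.
Qed.

(** The product measure is the integral over x of the measures of the vertical sections, all zero
    here. *)
Lemma lebesgue_measure2_countable_sections (R : realType) (A : set (R * R)) :
  (forall x, countable (xsection A x)) -> lebesgue_measure2 A = 0%E.
Proof.
move=> cA; apply: integral0_eq => x _ /=.
exact: countable_lebesgue_measure0.
Qed.

Theorem theorem3 (R : realType) :
  exists C : 'I_25 -> set (R * R),
    jordan_measurable_coloring C /\
    forall i : 'I_25, ~ contains_rectangle_vertices (C i) 1.
Proof.
exists (@colour_class R); split; last exact: colour_class_no_unit_rectangle.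
split=> [|k]; first exact: colour_class_coloring.
apply: lebesgue_measure2_countable_sections => x.
pose S s := [set y : R | qform s (x, y) \is a Num.int].
(* The boolean index enumerates the two signs s = 1 and s = -1. *)
apply: (sub_countable (B := \bigcup_(b : bool) S ((-1) ^+ b))).
  apply: subset_card_le => y; rewrite xsectionE => /boundary_colour_class.
  by case=> ?; [exists true | exists false]; rewrite // /S /= ?expr1 ?expr0.
by apply: bigcup_countable => // b _; exact: countable_qform_section.
Qed.
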